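(* Let $S$ be a densely defined nonnegative symmetric operator in a separable complex Hilbert space $\mathfrak H$, and let $\widetilde S_0,\widetilde S_1$ be two nonnegative selfadjoint extensions of $S$ such that $\operatorname{dom}\widetilde S_1\cap\operatorname{dom}\widetilde S_0=\operatorname{dom}S$ and the form $\widetilde S_0[\cdot,\cdot]$ is a closed restriction of the form $\widetilde S_1[\cdot,\cdot]$. Let $\{\mathcal H,\Gamma_0\}$ be a boundary pair for $\{\widetilde S_0,\widetilde S_1\}$. Then there exists a unique linear operator $\Gamma_1:\mathcal L\to\mathcal H$ such that $$\widetilde S_1[u,v]=(S^*u,v)-(\Gamma_1u,\Gamma_0v)_{\mathcal H}\quad\text{for all }u\in\mathcal L\text{ and all }v\in\mathcal D[\widetilde S_1].$$ The operator $\Gamma_1$ is bounded from the Hilbert space $\mathcal L$, equipped with the inner product $(u,v)_{\widetilde\eta}=\widetilde S_1[u,v]+(u,v)+(S^*u,S^*v)$, to the Hilbert space $\mathcal H$. Moreover, $$\ker\Gamma_1=\operatorname{dom}\widetilde S_1,\qquad\operatorname{ran}\Gamma_1=\mathcal H.$$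
   Context: For a nonnegative selfadjoint operator $T$: $\mathcal D[T]=\operatorname{dom}T^{1/2}$, $T[u,v]=(T^{1/2}u,T^{1/2}v)$. ''$\widetilde S_0[\cdot,\cdot]$ is a closed restriction of $\widetilde S_1[\cdot,\cdot]$'' means $\mathcal D[\widetilde S_0]\subset\mathcal D[\widetilde S_1]$ and the forms agree on $\mathcal D[\widetilde S_0]$. The space $\mathcal D[\widetilde S_1]$ is a Hilbert space with inner product $(u,v)_{\widetilde S_1}=\widetilde S_1[u,v]+(u,v)$, and $\mathcal D[\widetilde S_1]\ominus_{\widetilde S_1}\mathcal D[\widetilde S_0]$ denotes the orthogonal complement of $\mathcal D[\widetilde S_0]$ in it. The linear manifold $\mathcal L$ is the direct sum $$\mathcal L:=\operatorname{dom}\widetilde S_0\dotplus\big(\mathcal D[\widetilde S_1]\ominus_{\widetilde S_1}\mathcal D[\widetilde S_0]\big);$$ it satisfies $\mathcal L\subset\mathcal D[\widetilde S_1]\cap\operatorname{dom}S^*$. A boundary pair for $\{\widetilde S_0,\widetilde S_1\}$ is a pair $\{\mathcal H,\Gamma_0\}$ where $\mathcal H$ is a Hilbert space and $\Gamma_0$ is a continuous linear operator from the Hilbert space $\mathcal D[\widetilde S_1]$ into $\mathcal H$ with $\ker\Gamma_0=\mathcal D[\widetilde S_0]$ and $\operatorname{ran}\Gamma_0=\mathcal H$. *)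

(* Defs.v *)
From HB Require Import structures.
From mathcomp Require Import all_boot all_order all_algebra.
From mathcomp Require Import all_classical all_reals all_analysis.
From mathcomp Require Import complex.

Set Implicit Arguments.
Unset Strict Implicit.
Unset Printing Implicit Defensive.

Import Order.TTheory GRing.Theory Num.Theory numFieldNormedType.Exports.
Local Open Scope classical_set_scope.
Local Open Scope ring_scope.

(* Complex Hilbert spaces: the scalars are R[i] with R : realType.  By the
   convention of {dot _ for _}, the inner product is linear in its first
   argument and conjugate-linear in the second. *)
HB.mixin Record CompleteNormedModule_isHilbert (R : realType) (H : Type)
    of CompleteNormedModule R[i] H := {
  hdot : {dot H for Num.conj} ;
  hnormE : forall u : H, `|u| = sqrtC (hdot u u)
}.

#[short(type="hilbertType")]
HB.structure Definition Hilbert (R : realType) :=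
  {H of CompleteNormedModule_isHilbert R H & CompleteNormedModule R[i] H}.

Notation "''[' u , v ]" := (hdot u v) : ring_scope.

Definition separable_space (T : topologicalType) :=
  exists2 A : set T, countable A & dense A.

(* A possibly unbounded operator, not necessarily everywhere defined, is
   identified with its graph.  Hence T `<=` T' says that T' extends T, and
   equality of graphs is equality of operators, including their domains. *)
Section Operators.
Variables (R : realType) (H K : hilbertType R).
Implicit Types (T : set (H * K)) (u : H) (w : K).

Definition linear_operator T :=
  [/\ T (0, 0),
      forall (a : R[i]) p q, T p -> T q -> T (a *: p + q) &
      forall u w w', T (u, w) -> T (u, w') -> w = w'].

Definition opdom T : set H := [set u | exists w, T (u, w)].
Definition opran T : set K := [set w | exists u, T (u, w)].
Definition opker T : set H := [set u | T (u, 0)].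

(* The value T u; it is 0 outside the domain. *)
Definition opapp T u : K := xget 0 [set w | T (u, w)].

(* The graph of an operator when T is densely defined. *)
Definition adjoint T : set (K * H) :=
  [set p | forall u w, T (u, w) -> '[w, p.1] = '[u, p.2]].

(* Continuity and boundedness on a domain D normed by a form e, which in
   general is not the restriction of the inner product of H. *)
Definition continuous_on (D : set H) (e : H -> H -> R[i]) T :=
  forall u, D u -> forall eps : R[i], 0 < eps ->
  exists2 delta : R[i], 0 < delta &
    forall v, D v -> sqrtC (e (v - u) (v - u)) < delta ->
      `|opapp T v - opapp T u| < eps.

Definition bounded_on (D : set H) (e : H -> H -> R[i]) T :=
  exists2 M : R[i], 0 <= M &
    forall u, D u -> `|opapp T u| <= M * sqrtC (e u u).

End Operators.

Section SelfadjointOperators.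
Variables (R : realType) (H : hilbertType R).
Implicit Types (T S : set (H * H)) (u v : H).

Definition op_comp T2 T1 : set (H * H) :=
  [set p | exists w, T1 (p.1, w) /\ T2 (w, p.2)].

Definition symmetric_op T :=
  forall u v, opdom T u -> opdom T v -> '[opapp T u, v] = '[u, opapp T v].

Definition nonnegative_op T := forall u, opdom T u -> 0 <= '[opapp T u, u].

Definition selfadjoint T :=
  [/\ linear_operator T, dense (opdom T) & adjoint T = T].

(* The square root T^{1/2} of a nonnegative selfadjoint T is the unique
   nonnegative selfadjoint Q with Q Q = T; set0 is only the junk value taken
   when there is no such Q. *)
Definition is_sqrt T Q :=
  [/\ selfadjoint Q, nonnegative_op Q & op_comp Q Q = T].

Definition opsqrt T : set (H * H) := xget set0 [set Q | is_sqrt T Q].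

(* D[T] and T[u, v] *)
Definition formdom T : set H := opdom (opsqrt T).

Definition opform T u v : R[i] := '[opapp (opsqrt T) u, opapp (opsqrt T) v].

Definition closed_form_restriction S0 S1 :=
  formdom S0 `<=` formdom S1 /\
  forall u v, formdom S0 u -> formdom S0 v -> opform S0 u v = opform S1 u v.

(* The inner product of D[T]. *)
Definition form_dot T u v : R[i] := opform T u v + '[u, v].

Definition form_ortho S0 S1 : set H :=
  [set u | formdom S1 u /\ forall v, formdom S0 v -> form_dot S1 u v = 0].

(* The sum is direct: an element n of form_ortho S0 S1 lying in dom S0 is
   orthogonal to itself for form_dot S1. *)
Definition manifoldL S0 S1 : set H :=
  [set u | exists f n, [/\ opdom S0 f, form_ortho S0 S1 n & u = f + n]].

Definition eta_dot S S1 u v : R[i] :=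
  opform S1 u v + '[u, v] + '[opapp (adjoint S) u, opapp (adjoint S) v].

(* The linear manifold D with the inner product e is a Hilbert space. *)
Definition hilbert_on (D : set H) (e : H -> H -> R[i]) :=
  [/\ D 0 /\ (forall (a : R[i]) u v, D u -> D v -> D (a *: u + v)),
      forall (a : R[i]) u u' v, D u -> D u' -> D v ->
        e (a *: u + u') v = a * e u v + e u' v,
      forall u v, D u -> D v -> e u v = (e v u)^*,
      forall u, D u -> u != 0 -> 0 < e u u &
      forall x : nat -> H, (forall n, D (x n)) ->
        (forall eps : R[i], 0 < eps -> exists N, forall m n,
          (N <= m)%N -> (N <= n)%N -> sqrtC (e (x m - x n) (x m - x n)) < eps) ->
        exists2 u, D u & forall eps : R[i], 0 < eps -> exists N, forall n,
          (N <= n)%N -> sqrtC (e (x n - u) (x n - u)) < eps].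

End SelfadjointOperators.

Definition boundary_pair (R : realType) (H K : hilbertType R)
    (S0 S1 : set (H * H)) (Gamma0 : set (H * K)) :=
  [/\ linear_operator Gamma0 /\ opdom Gamma0 = formdom S1,
      continuous_on (formdom S1) (form_dot S1) Gamma0,
      opker Gamma0 = formdom S0 &
      opran Gamma0 = setT].

(* Main.v *)
Require Import Defs.
From mathcomp Require Import all_boot all_order all_algebra.
From mathcomp Require Import all_classical all_reals all_analysis.
From mathcomp Require Import complex ring lra.

(* Each form domain D[T], with the inner product T[u,v] + (u,v), is a Hilbert
   space isometric to the graph of T^(1/2), and the Riesz theorem there gives
   the resolvent.  It follows that L consists of the u in D[S1] and dom S* with
   S1[u,v] = (S* u,v) for all v in D[S0], a closed condition.  For u in L, the
   functional v |-> (v,S* u) - S1[v,u] thus vanishes on D[S0] = ker Gamma0.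
   As Gamma0 is onto, uniform boundedness shows that its adjoint
   Gamma0^* : K -> D[S1] is bounded below, so its range is the whole orthogonal
   complement of ker Gamma0; the functional is therefore v |-> (Gamma0 v, k)
   for a unique k, which is Gamma1 u.  Gamma1 is onto because - Gamma0^* k lies
   in L and is sent to k. *)

Set Implicit Arguments.
Unset Strict Implicit.
Unset Printing Implicit Defensive.

Import Order.TTheory GRing.Theory Num.Theory numFieldNormedType.Exports.
Local Open Scope classical_set_scope.
Local Open Scope ring_scope.
Local Open Scope complex_scope.

(** * Real inner products on a subset of a complex space *)

Section RealHilbert.
Variables (R : realType) (V : lmodType R[i]).

(** [r] will be the real part of a complex inner product, so only real scalars [t%:C] occur. The
    axioms hold on [D] alone, since a form means nothing off its domain. Completeness uses squared
    distances, which avoids square roots. *)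
Record real_hilbert (D : set V) (r : V -> V -> R) : Prop := RealHilbert {
  rh0 : D 0;
  rhP : forall (t : R) u v, D u -> D v -> D (t%:C *: u + v);
  rh_lin : forall (t : R) u v w, D u -> D v -> D w ->
    r (t%:C *: u + v) w = t * r u w + r v w;
  rhC : forall u v, D u -> D v -> r u v = r v u;
  rh_gt0 : forall u, D u -> u != 0 -> 0 < r u u;
  rh_complete : forall x : nat -> V, (forall n, D (x n)) ->
    (forall eps : R, 0 < eps -> exists N, forall m n,
      (N <= m)%N -> (N <= n)%N -> r (x m - x n) (x m - x n) < eps) ->
    exists2 u, D u & forall eps : R, 0 < eps -> exists N, forall n,
      (N <= n)%N -> r (x n - u) (x n - u) < eps }.

Variables (D : set V) (r : V -> V -> R).
Hypothesis hr : real_hilbert D r.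

Let D0 : D 0 := rh0 hr.

Lemma rhZ (t : R) u : D u -> D (t%:C *: u).
Proof. by move=> Du; rewrite -[_ *: _]addr0; exact: (rhP hr). Qed.

Lemma rhD u v : D u -> D v -> D (u + v).
Proof. by move=> Du Dv; rewrite -[u]scale1r; exact: (rhP hr 1). Qed.

Let opprE (u : V) : - u = (-1)%:C *: u.
Proof. by rewrite rmorphN1 scaleN1r. Qed.

Lemma rhB u v : D u -> D v -> D (u - v).
Proof. by move=> Du Dv; rewrite addrC opprE; exact: (rhP hr). Qed.

Lemma rh_linr (t : R) u v w : D u -> D v -> D w ->
  r w (t%:C *: u + v) = t * r w u + r w v.
Proof.
move=> Du Dv Dw; rewrite (rhC hr Dw (rhP hr _ Du Dv)) (rh_lin hr)//.
by rewrite (rhC hr Dw Du) (rhC hr Dw Dv).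
Qed.

Lemma rh0l w : D w -> r 0 w = 0.
Proof.
move=> Dw; have := rh_lin hr 1 D0 D0 Dw.
rewrite scaler0 addr0; lra.
Qed.

Lemma rh0r w : D w -> r w 0 = 0.
Proof. by move=> Dw; rewrite (rhC hr)// rh0l. Qed.

Lemma rhZl (t : R) u w : D u -> D w -> r (t%:C *: u) w = t * r u w.
Proof. by move=> Du Dw; rewrite -[_ *: _]addr0 (rh_lin hr)// rh0l// addr0. Qed.

Lemma rhBl u v w : D u -> D v -> D w -> r (u - v) w = r u w - r v w.
Proof.
move=> Du Dv Dw; have := rh_lin hr (-1) Dv Du Dw.
by rewrite rmorphN1 scaleN1r addrC => ->; ring.
Qed.

Lemma rh_quad (t : R) u v : D u -> D v ->
  r (t%:C *: u + v) (t%:C *: u + v) =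
  t ^+ 2 * r u u + 2 * t * r u v + r v v.
Proof.
move=> Du Dv; have Duv := rhP hr t Du Dv.
by rewrite (rh_lin hr)// !rh_linr// (rhC hr Dv Du); ring.
Qed.

Lemma rh_ge0 u : D u -> 0 <= r u u.
Proof.
move=> Du; have [->|/(rh_gt0 hr Du)/ltW//] := eqVneq u 0.
by rewrite rh0l.
Qed.

Lemma rh_eq0 u : D u -> r u u = 0 -> u = 0.
Proof.
move=> Du ru; apply/eqP/negP => /negP/(rh_gt0 hr Du).
by rewrite ru ltxx.
Qed.

Definition rnorm u := Num.sqrt (r u u).

Lemma rnorm_ge0 u : 0 <= rnorm u. Proof. exact: sqrtr_ge0. Qed.

Lemma sqr_rnorm u : D u -> rnorm u ^+ 2 = r u u.
Proof. by move=> Du; rewrite sqr_sqrtr// rh_ge0. Qed.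

Lemma rnorm0 : rnorm 0 = 0.
Proof. by rewrite /rnorm rh0l// sqrtr0. Qed.

Lemma rnorm_gt0 u : D u -> u != 0 -> 0 < rnorm u.
Proof. by move=> Du u0; rewrite sqrtr_gt0 (rh_gt0 hr). Qed.

Lemma rnormZ (t : R) u : D u -> rnorm (t%:C *: u) = `|t| * rnorm u.
Proof.
move=> Du; rewrite /rnorm rhZl//; last exact: rhZ.
rewrite (rhC hr)//; last exact: rhZ.
by rewrite rhZl// mulrA -expr2 sqrtrM ?sqr_ge0// sqrtr_sqr.
Qed.

Lemma rh_CauchySchwarz u v : D u -> D v -> `|r u v| <= rnorm u * rnorm v.
Proof.
move=> Du Dv; have [->|v0] := eqVneq v 0.
  by rewrite rh0r// normr0 mulr_ge0// rnorm_ge0.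
have rv := rh_gt0 hr Dv v0; have ru := rh_ge0 Du.
rewrite /rnorm -sqrtrM// -sqrtr_sqr ler_sqrt ?mulr_ge0 ?(ltW rv)//.
(* Nonnegativity at [u] minus its projection on [v], multiplied by [r v v]. *)
have := rh_ge0 (rhP hr (- (r u v / r v v)) Dv Du).
rewrite rh_quad// (rhC hr Dv Du) -(pmulr_rge0 _ rv).
set a := r u v; set b := r u u; set c := r v v in rv *.
have -> : c * ((- (a / c)) ^+ 2 * c + 2 * - (a / c) * a + b) =
  b * c - a ^+ 2 by field; exact: lt0r_neq0.
by rewrite subr_ge0.
Qed.

Lemma rh_sqrD u v : D u -> D v ->
  r (u + v) (u + v) = r u u + 2 * r u v + r v v.
Proof.
move=> Du Dv; have uE : 1%:C *: u = u by exact: scale1r.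
have := rh_quad 1 Du Dv; rewrite uE => ->; ring.
Qed.

Lemma rh_sqrB u v : D u -> D v ->
  r (u - v) (u - v) = r u u - 2 * r u v + r v v.
Proof.
move=> Du Dv; have := rh_quad (-1) Dv Du.
rewrite rmorphN1 scaleN1r [- v + u]addrC (rhC hr Dv Du) => ->; ring.
Qed.

Lemma rnormD u v : D u -> D v -> rnorm (u + v) <= rnorm u + rnorm v.
Proof.
move=> Du Dv; rewrite -(ler_pXn2r (n:=2))// ?nnegrE ?addr_ge0 ?rnorm_ge0//.
rewrite sqr_rnorm; last exact: rhD.
rewrite rh_sqrD// sqrrD !sqr_rnorm//; have := rh_CauchySchwarz Du Dv.
by move=> /(le_trans (ler_norm _)); lra.
Qed.

Lemma rnormC u v : D u -> D v -> rnorm (u - v) = rnorm (v - u).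
Proof.
move=> Du Dv; rewrite (_ : u - v = (-1)%:C *: (v - u)); last first.
  by rewrite -opprE opprB.
by rewrite rnormZ ?normrN1 ?mul1r//; exact: rhB.
Qed.

Lemma rh_parallelogram u v : D u -> D v ->
  r (u - v) (u - v) + r (u + v) (u + v) = 2 * r u u + 2 * r v v.
Proof.
by move=> Du Dv; rewrite rh_sqrB// rh_sqrD//; ring.
Qed.

Lemma rh_complete_rnorm (x : nat -> V) : (forall n, D (x n)) ->
  (forall eps : R, 0 < eps -> exists N, forall m n,
     (N <= m)%N -> (N <= n)%N -> rnorm (x m - x n) < eps) ->
  exists2 u, D u & forall eps : R, 0 < eps -> exists N, forall n,
      (N <= n)%N -> rnorm (x n - u) < eps.
Proof.
move=> Dx cx; case: (rh_complete hr Dx) => [eps e0|u Du ux].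
  have [|N xN] := cx (Num.sqrt eps); first by rewrite sqrtr_gt0.
  exists N => m n Nm Nn; have := xN m n Nm Nn.
  by rewrite ltr_sqrt.
exists u => // eps e0.
have [|N xN] := ux (eps ^+ 2); first by rewrite exprn_gt0.
exists N => n /xN; rewrite -ltr_sqrt ?exprn_gt0//.
by rewrite sqrtr_sqr gtr0_norm.
Qed.

End RealHilbert.

Lemma invSn_lt (R : realType) (eps : R) : 0 < eps ->
  exists N : nat, forall n, (N <= n)%N -> n.+1%:R^-1 < eps.
Proof.
move=> e0; exists (Num.truncn eps^-1) => n Nn.
rewrite invf_plt ?posrE ?ltr0n//.
by rewrite (lt_le_trans (truncnS_gt _))// ler_nat ltnS.
Qed.

(** * Riesz representation by minimization *)

Section Riesz.
Variables (R : realType) (V : lmodType R[i]).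
Variables (D : set V) (r : V -> V -> R).
Hypothesis hr : real_hilbert D r.

Variables (f : V -> R) (C : R).
Hypothesis f_lin : forall (t : R) u v, D u -> D v ->
  f (t%:C *: u + v) = t * f u + f v.
Hypothesis f_bound : forall v, D v -> `|f v| <= C * rnorm r v.

(** The energy functional: if [f] is represented by [w], then [J v = |v - w|^2 - |w|^2], so the
    representing vector is the minimizer. *)
Let J v := r v v - 2 * f v.

Let J_quad (t : R) u v : D u -> D v ->
  J (t%:C *: u + v) = t ^+ 2 * r u u + 2 * t * (r u v - f u) + J v.
Proof. by move=> Du Dv; rewrite /J (rh_quad hr)// f_lin//; ring. Qed.

Let J_has_inf : has_inf [set J v | v in D].
Proof.
split; first by exists (J 0); exists 0 => //; exact: (rh0 hr).
(* The lower bound comes from [(|v| - C)^2 >= 0]. *)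
exists (- C ^+ 2) => _ [v Dv <-]; rewrite /J -(sqr_rnorm hr)//.
have := f_bound Dv; have := sqr_ge0 (rnorm r v - C).
rewrite ler_norml => h /andP[_ h']; nra.
Qed.

Let m := inf [set J v | v in D].

Let m_le v : D v -> m <= J v.
Proof. by move=> Dv; apply: (ge_inf J_has_inf.2); exists v. Qed.

Let J_min : exists2 w, D w & J w <= m.
Proof.
have xP n : exists x, D x /\ J x < m + n.+1%:R^-1.
  have [|_ [x Dx <-] Jx] := inf_adherent (eps := n.+1%:R^-1) _ J_has_inf.
    by rewrite invr_gt0 ltr0n.
  by exists x.
have [x xD] := choice xP.
have Dx n : D (x n) by have [] := xD n.
have Jx n : J (x n) < m + n.+1%:R^-1 by have [] := xD n.
(* A minimizing sequence is Cauchy: by the parallelogram law the left side is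
   [2 J (x k) + 2 J (x n) - 4 J p], where [p] is the midpoint and [J p >= m]. *)
have dist2 k n : r (x k - x n) (x k - x n) <= 2 * (k.+1%:R^-1 + n.+1%:R^-1).
  have hP : D ((2^-1)%:C *: (x k + x n)) by apply: (rhZ hr); exact: (rhD hr).
  have Df : D (x k + x n) by exact: (rhD hr).
  have := rh_parallelogram hr (Dx k) (Dx n); have := m_le hP.
  have := J_quad 2^-1 Df (rh0 hr); rewrite addr0 (rh0r hr)//.
  have -> : J 0 = 0.
    have := f_lin 1 (rh0 hr) (rh0 hr); rewrite scaler0 addr0 /J.
    rewrite (rh0l hr); last exact: (rh0 hr).
    lra.
  have -> : f (x k + x n) = f (x k) + f (x n).
    by have := f_lin 1 (Dx k) (Dx n); rewrite mul1r => <-; rewrite scale1r.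
  have := Jx k; have := Jx n; rewrite /J.
  set a := k.+1%:R^-1; set b := n.+1%:R^-1.
  lra.
have [|w Dw xw] := rh_complete hr Dx.
  move=> eps e0.
  have [|N NP] := @invSn_lt R (eps / 4); first by rewrite divr_gt0.
  exists N => k n /NP hk /NP hn; apply: le_lt_trans (dist2 k n) _.
  by move: hk hn; set a := k.+1%:R^-1; set b := n.+1%:R^-1; lra.
exists w => //; apply/ler_addgt0Pr => eps e0.
(* With [d = x n - w], [J w <= J (x n) + 2 (|w| + |C|) |d|]. The extra 1 keeps [c] positive, and
   [eps] is split between [J (x n) - m] and [c |d|]. *)
pose c := 2 * (rnorm r w + `|C|) + 1.
have c0 : 0 < c by have := rnorm_ge0 r w; have := normr_ge0 C; rewrite /c; lra.
have [|N1 N1P] := @invSn_lt R (eps / 2); first by rewrite divr_gt0.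
have [|N2 N2P] := xw ((eps / (2 * c)) ^+ 2).
  by rewrite exprn_gt0// divr_gt0// mulr_gt0.
pose n := maxn N1 N2.
have := N1P n (leq_maxl _ _); have := N2P n (leq_maxr _ _).
have Dd : D (x n - w) by exact: (rhB hr).
rewrite -(sqr_rnorm hr)// ltr_pXn2r ?nnegrE ?rnorm_ge0//; last first.
  by rewrite ltW// divr_gt0// mulr_gt0.
rewrite ltr_pdivlMr ?mulr_gt0// => h1 h2.
have := J_quad 1 Dd Dw; rewrite (_ : 1%:C *: (x n - w) + w = x n); last first.
  by rewrite scale1r subrK.
have := Jx n; have := rh_ge0 hr Dd.
have := rh_CauchySchwarz hr Dd Dw; rewrite ler_norml => /andP[h3 _].
have := f_bound Dd; rewrite ler_norml => /andP[_ h4].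
have := ler_wpM2r (rnorm_ge0 r (x n - w)) (ler_norm C).
have := rnorm_ge0 r (x n - w).
move: h1 h2 h3 h4; rewrite /c.
set d := rnorm r (x n - w); set q := n.+1%:R^-1.
nra.
Qed.

Theorem real_riesz : exists2 w, D w & forall v, D v -> f v = r v w.
Proof.
have [w Dw Jw] := J_min; exists w => // v Dv.
pose b := r v w - f v; pose a := r v v.
have a0 : 0 <= a by exact: (rh_ge0 hr).
have a1 : a + 1 != 0 by rewrite gt_eqF//; lra.
suff : b ^+ 2 <= 0 by rewrite real_exprn_even_le0//= ?num_real// /b; lra.
(* The first variation at the minimizer, in the direction [v]. The optimal step would be [- b / a];
   [a + 1] also covers [a = 0]. *)
have := m_le (rhP hr (- (b / (a + 1))) Dv Dw).
rewrite J_quad// -/a -/b => /(le_trans Jw).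
have -> : (- (b / (a + 1))) ^+ 2 * a + 2 * - (b / (a + 1)) * b + J w =
  J w - b ^+ 2 * ((a + 2) / (a + 1) ^+ 2) by field.
move=> h; have h' : b ^+ 2 * ((a + 2) / (a + 1) ^+ 2) <= 0 by lra.
move: h'; rewrite pmulr_lle0// divr_gt0//; first lra.
rewrite exprn_gt0//; lra.
Qed.

End Riesz.

(** * The uniform boundedness principle *)

Section UniformBoundedness.
Variables (R : realType) (V : lmodType R[i]).
Variables (D : set V) (r : V -> V -> R).
Hypothesis hr : real_hilbert D r.

(* Sokal's gliding hump: if the [a n] in [A] grow fast, then the series of the
   [+/- 3^-n a_n / |a_n|], with suitable signs, converges to an [x] for which
   [r x a_n] is unbounded. *)
Theorem uniform_boundedness (A : set V) : A `<=` D ->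
  (forall x, D x -> exists C : R, forall a, A a -> `|r x a| <= C) ->
  exists C : R, forall a, A a -> rnorm r a <= C.
Proof.
move=> AD Abnd; apply: contrapT => /forallNP unb.
have {unb}aP n : exists a, A a /\ 2 * 3 ^+ n * n.+1%:R < rnorm r a.
  apply: contrapT => /forallNP h; apply: (unb (2 * 3 ^+ n * n.+1%:R)) => a Aa.
  by rewrite leNgt; apply/negP => ra; exact: (h a).
have [a aA] := choice aP.
have Aa n : A (a n) by case: (aA n).
have Da n : D (a n) by exact: AD.
have a_gt n : 2 * 3 ^+ n * n.+1%:R < rnorm r (a n) by case: (aA n).
have p3 n : 0 < 3 ^+ n :> R by rewrite exprn_gt0.
have a_gt0 n : 0 < rnorm r (a n).
  by apply: lt_trans (a_gt n); rewrite !mulr_gt0// ltr0n.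
pose s y n : R := if 0 <= r y (a n) then 1 else -1.
pose x := fix x n := if n is n'.+1 then
  (s (x n') n' * (3 ^+ n')^-1 / rnorm r (a n'))%:C *: a n' + x n' else 0.
have Dx n : D (x n).
  by elim: n => [|n IH]; [exact: (rh0 hr)|exact: (rhP hr)].
have x_step n : rnorm r (x n.+1 - x n) = (3 ^+ n)^-1.
  rewrite /= addrK (rnormZ hr)// !normrM (_ : `|s _ _| = 1); last first.
    by rewrite /s; case: ifP; rewrite ?normrN normr1.
  by rewrite !gtr0_norm ?invr_gt0// mul1r divfK// gt_eqF.
(* The sign [s] makes the new term agree in sign with [r (x n) (a n)], so the two cannot cancel. *)
have x_far n : (3 ^+ n)^-1 * rnorm r (a n) <= `|r (x n.+1) (a n)|.
  rewrite /= (rh_lin hr)// -(sqr_rnorm hr)// /s.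
  set c := (3 ^+ n)^-1; set t := rnorm r (a n).
  have t0 : 0 < t by exact: a_gt0.
  have c0 : 0 < c by rewrite invr_gt0.
  have ct0 := mulr_gt0 c0 t0.
  case: ifP => [r0|/negbT]; last rewrite -ltNge => r0.
    rewrite mul1r expr2 mulrA divfK ?gt_eqF//.
    by rewrite (le_trans _ (ler_norm _))// lerDl.
  rewrite mulN1r expr2 mulrA divfK ?gt_eqF//.
  by rewrite -normrN (le_trans _ (ler_norm _))//; lra.
(* The right side is the geometric sum of the steps [3^-j] for [n <= j < n + k]. *)
have x_tail n k :
    rnorm r (x (n + k)%N - x n) <= 3 / 2 * ((3 ^+ n)^-1 - (3 ^+ (n + k))^-1).
  elim: k => [|k IH]; first by rewrite addn0 !subrr mulr0 (rnorm0 hr).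
  rewrite addnS -(subrKA (x (n + k)%N)).
  apply: le_trans (rnormD hr _ _) _; [exact: (rhB hr)|exact: (rhB hr)|].
  rewrite x_step exprS invfM; move: IH.
  by set u := (3 ^+ (n + k))^-1; lra.
have x_tail' n k : (n <= k)%N -> rnorm r (x k - x n) <= 3 / 2 * (3 ^+ n)^-1.
  move=> nk; rewrite -(subnKC nk); apply: le_trans (x_tail _ _) _.
  have : 0 < (3 ^+ (n + (k - n)))^-1 :> R by rewrite invr_gt0.
  by lra.
have inv3 n : (3 ^+ n)^-1 <= n.+1%:R^-1 :> R.
  by rewrite lef_pV2 ?posrE// -natrX ler_nat ltn_expl.
have [|y Dy xy] := rh_complete_rnorm hr Dx.
  move=> eps e0; have [|N NP] := @invSn_lt R (eps / 3).
    by rewrite divr_gt0.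
  exists N => k n Nk Nn; rewrite -(subrKA (x N)).
  apply: le_lt_trans (rnormD hr _ _) _; [exact: (rhB hr)|exact: (rhB hr)|].
  rewrite (rnormC hr (Dx N))//.
  have := x_tail' _ _ Nk; have := x_tail' _ _ Nn.
  have := NP N (leqnn _); have := inv3 N.
  by set p := (3 ^+ N)^-1; set q := N.+1%:R^-1; lra.
have y_near n : rnorm r (y - x n) <= 3 / 2 * (3 ^+ n)^-1.
  apply/ler_addgt0Pr => eps e0; have [N NP] := xy eps e0.
  pose k := maxn N n; rewrite -(subrKA (x k)).
  apply: le_trans (rnormD hr _ _) _; [exact: (rhB hr)|exact: (rhB hr)|].
  rewrite (rnormC hr Dy)//.
  have := x_tail' _ _ (leq_maxr N n : n <= k)%N.
  by have := NP k (leq_maxl _ _); lra.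
have [C CP] := Abnd y Dy.
(* The tail after [x n.+1] has norm at most [3^-n / 2], half of step [n]. Hence [|r y (a n)| >= 3^-n
   |a n| / 2 > n + 1 > C]. *)
pose n := Num.truncn C.
have Cn : C < n.+1%:R by exact: truncnS_gt.
have := CP _ (Aa n); have := x_far n.
have Dyx : D (y - x n.+1) by exact: (rhB hr).
have := rh_CauchySchwarz hr Dyx (Da n); rewrite (rhBl hr)//.
have := ler_wpM2r (ltW (a_gt0 n)) (y_near n.+1).
rewrite exprS invfM => h1 h2 h3 h4.
have := le_trans (lerB_dist (r (x n.+1) (a n)) (r y (a n))); rewrite distrC.
move=> /(_ _ h2) h5.
have h6 : 2 * n.+1%:R < (3 ^+ n)^-1 * rnorm r (a n).
  by rewrite ltr_pdivlMl// mulrCA mulrA.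
by move: h1 h3 h4 h5 h6; set z := (3 ^+ n)^-1; set t := rnorm r (a n); nra.
Qed.

End UniformBoundedness.

(** * Real parts of complex scalars *)

Local Notation Re := complex.Re.

Lemma gt0_ReE (R : realType) (z : R[i]) : 0 < z -> (Re z)%:C = z /\ 0 < Re z.
Proof.
case: z => a b; rewrite ltcE /= => /andP[/eqP -> a0]; split => //.
Qed.

Lemma ge0_ReE (R : realType) (z : R[i]) : 0 <= z -> (Re z)%:C = z /\ 0 <= Re z.
Proof. by case: z => a b; rewrite lecE /= => /andP[/eqP ->]. Qed.

Lemma sqrtC_Re (R : realType) (z : R[i]) :
  0 <= z -> sqrtC z = (Num.sqrt (Re z))%:C.
Proof.
move=> /ge0_ReE[zE z0].
have {1}<- : (Num.sqrt (Re z))%:C ^+ 2 = z.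
  by rewrite -rmorphXn/= sqr_sqrtr.
by rewrite sqrCK// lecR sqrtr_ge0.
Qed.

Lemma cReD (R : realType) (z w : R[i]) : Re (z + w) = Re z + Re w.
Proof. by case: z; case: w. Qed.

Lemma cReB (R : realType) (z w : R[i]) : Re (z - w) = Re z - Re w.
Proof. by case: z; case: w. Qed.

Lemma cReM (R : realType) (t : R) (z : R[i]) : Re (t%:C * z) = t * Re z.
Proof. by case: z => a b /=; rewrite mul0r subr0. Qed.

Lemma cReJ (R : realType) (z : R[i]) : Re (z^*)%R = Re z.
Proof. by case: z. Qed.

(** [c = 1] recovers the real part and [c = 'i] the imaginary part. This lifts results on the real
    forms to the complex ones. *)
Lemma Re_eq (R : realType) (z w : R[i]) :
  (forall c : R[i], Re (c * z) = Re (c * w)) -> z = w.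
Proof.
case: z => a b; case: w => a' b' h; have := h 1; have := h 'i; rewrite /=.
rewrite !mul0r !mul1r !sub0r !subr0 => /oppr_inj -> -> //.
Qed.

(** * Complex inner products on a linear manifold *)

Section HilbertOn.
Variables (R : realType) (H : hilbertType R).
Implicit Types (D : set H) (e : H -> H -> R[i]).

Definition reform e (u v : H) : R := Re (e u v).

Variables (D : set H) (e : H -> H -> R[i]).
Hypothesis he : hilbert_on D e.

Lemma hilbert_onP (a : R[i]) u v : D u -> D v -> D (a *: u + v).
Proof. by case: he => -[_ h] _ _ _ _; exact: h. Qed.

Lemma hilbert_on0 : D 0.
Proof. by case: he => -[]. Qed.

Lemma hilbert_on_lin (a : R[i]) u v w : D u -> D v -> D w ->
  e (a *: u + v) w = a * e u w + e v w.
Proof. by case: he => _ h _ _ _; exact: h. Qed.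

Lemma hilbert_on_conj u v : D u -> D v -> e u v = ((e v u)^*)%R.
Proof. by case: he => _ _ h _ _; exact: h. Qed.

Lemma hilbert_on_ge0 u : D u -> 0 <= e u u.
Proof.
move=> Du; have [->|u0] := eqVneq u 0; last first.
  by apply: ltW; case: he => _ _ _ h _; exact: h.
have := hilbert_on_lin 1 hilbert_on0 hilbert_on0 hilbert_on0.
rewrite scaler0 addr0 mul1r => /eqP; rewrite -subr_eq subrr eq_sym => /eqP ->.
exact: lexx.
Qed.

Lemma hilbert_on_sqrtC u : D u -> sqrtC (e u u) = (rnorm (reform e) u)%:C.
Proof. by move=> Du; rewrite sqrtC_Re// hilbert_on_ge0. Qed.

Lemma hilbert_on_real : real_hilbert D (reform e).
Proof.
split.
- exact: hilbert_on0.
- by move=> t; exact: hilbert_onP.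
- by move=> t u v w Du Dv Dw; rewrite /reform hilbert_on_lin// cReD cReM.
- by move=> u v Du Dv; rewrite /reform hilbert_on_conj// cReJ.
- move=> u Du u0; case: he => _ _ _ /(_ u Du u0)/gt0_ReE[_ h] _.
  exact: h.
- move=> x Dx cx; case: he => _ _ _ _ /(_ x Dx)[|u Du ux].
    move=> eps /gt0_ReE[<- e0].
    have [|N NP] := cx (Re eps ^+ 2); first by rewrite exprn_gt0.
    exists N => m n Nm Nn.
    have Dmn : D (x m - x n) by rewrite addrC -scaleN1r; exact: hilbert_onP.
    rewrite hilbert_on_sqrtC// ltcR -(ger0_norm (ltW e0)) -sqrtr_sqr.
    by rewrite ltr_sqrt ?exprn_gt0// NP.
  exists u => // eps e0; have [|N NP] := ux (Num.sqrt eps)%:C.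
    by rewrite ltcR sqrtr_gt0.
  exists N => n /NP.
  have Dmn : D (x n - u) by rewrite addrC -scaleN1r; exact: hilbert_onP.
  by rewrite hilbert_on_sqrtC// ltcR ltr_sqrt.
Qed.

(** The real theorem represents the real part of [f]; applying it at [c *: v] for every complex [c]
    gives [f] itself through [Re_eq]. *)
Lemma hilbert_on_riesz (f : H -> R[i]) (C : R) :
  (forall (a : R[i]) u v, D u -> D v -> f (a *: u + v) = a * f u + f v) ->
  (forall v, D v -> `|Re (f v)| <= C * rnorm (reform e) v) ->
  exists2 w, D w & forall v, D v -> f v = e v w.
Proof.
move=> f_lin f_bnd.
have [|w Dw fw] := real_riesz hilbert_on_real (f := fun v => Re (f v)) _ f_bnd.
  by move=> t u v Du Dv; rewrite f_lin// cReD cReM.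
exists w => // v Dv; apply: Re_eq => c.
have D0 := hilbert_on0.
have f0 : f 0 = 0.
  have := f_lin 1 _ _ D0 D0.
  by rewrite scaler0 addr0 mul1r => /eqP; rewrite -subr_eq subrr eq_sym => /eqP.
have e0 : e 0 w = 0.
  have := hilbert_on_lin 1 D0 D0 Dw.
  by rewrite scaler0 addr0 mul1r => /eqP; rewrite -subr_eq subrr eq_sym => /eqP.
have := fw _ (hilbert_onP c Dv D0).
by rewrite /reform f_lin// hilbert_on_lin// f0 e0 !addr0.
Qed.

End HilbertOn.

(** * The inner product of the ambient space *)

Section HilbertSpace.
Variables (R : realType) (H : hilbertType R).

Definition hnorm : H -> R := rnorm (reform (@hdot R H)).

Lemma hdotP (a : R[i]) (u v w : H) : '[a *: u + v, w] = a * '[u, w] + '[v, w].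
Proof. exact: linearPl. Qed.

Lemma hdotC (u v : H) : '[u, v] = (('[v, u])^*)%R.
Proof. by rewrite hermC expr0 mul1r. Qed.

Lemma hdotD (u v w : H) : '[u + v, w] = '[u, w] + '[v, w].
Proof. exact: linearDl. Qed.

Lemma hdotB (u v w : H) : '[u - v, w] = '[u, w] - '[v, w].
Proof. exact: linearBl. Qed.

Lemma hdot0 (w : H) : '[0, w] = 0.
Proof. exact: linear0l. Qed.

Lemma hdot_ge0 (u : H) : 0 <= '[u, u].
Proof. exact: dnorm_ge0. Qed.

Lemma normE (u : H) : `|u| = (hnorm u)%:C.
Proof. by rewrite hnormE sqrtC_Re// hdot_ge0. Qed.

Lemma hdot_real : real_hilbert [set: H] (reform (@hdot R H)).
Proof.
split => //.
- by move=> t u v w _ _ _; rewrite /reform hdotP cReD cReM.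
- by move=> u v _ _; rewrite /reform hdotC cReJ.
- move=> u _ u0; have : 0 < '[u, u] by exact: neq0_dnorm_gt0.
  by move=> /gt0_ReE[].
- move=> x _ cx.
  (* Completeness of [H] concerns balls whose radii are positive elements of [R[i]]; this converts
     them to squared real norms. *)
  have small (eps : R) u : 0 < eps ->
      (reform (@hdot R H) u u < eps ^+ 2) = (`|u| < eps%:C).
    move=> e0; rewrite normE ltcR.
    rewrite -(ltr_sqrt (reform (@hdot R H) u u)) ?exprn_gt0//.
    by rewrite sqrtr_sqr gtr0_norm.
  have /cvg_ex[u ux] : cvg (x @ \oo).
    apply: cauchy_cvg; apply: cauchy_exP => eps /gt0_ReE[<- e0].
    have [|N NP] := cx (Re eps ^+ 2); first by rewrite exprn_gt0.
    exists (x N); exists N => // n /= Nn.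
    by rewrite -ball_normE /= -small// NP.
  exists u => // eps e0.
  have se0 : 0 < Num.sqrt eps by rewrite sqrtr_gt0.
  have sC0 : 0 < (Num.sqrt eps)%:C by rewrite ltcR.
  have [N _ NP] := (cvgrPdist_lt _ _).1 ux _ sC0.
  by exists N => n /NP /=; rewrite distrC -small// sqr_sqrtr// ltW.
Qed.

Lemma hnorm_ge0 (u : H) : 0 <= hnorm u. Proof. exact: rnorm_ge0. Qed.

Lemma Re_hdot (u : H) : Re '[u, u] = hnorm u ^+ 2.
Proof. by rewrite (sqr_rnorm hdot_real). Qed.

Lemma hdotE (u : H) : '[u, u] = (hnorm u ^+ 2)%:C.
Proof. by rewrite -Re_hdot (ge0_ReE (hdot_ge0 u)).1. Qed.

Lemma Re_CauchySchwarz (u v : H) : `|Re '[u, v]| <= hnorm u * hnorm v.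
Proof. exact: (rh_CauchySchwarz hdot_real). Qed.

Lemma hnorm_complete (x : nat -> H) :
  (forall eps : R, 0 < eps -> exists N, forall m n,
     (N <= m)%N -> (N <= n)%N -> hnorm (x m - x n) < eps) ->
  exists u, forall eps : R, 0 < eps -> exists N, forall n,
      (N <= n)%N -> hnorm (x n - u) < eps.
Proof.
by move=> /(rh_complete_rnorm hdot_real)[]// u _ ux; exists u.
Qed.

Lemma hdot_ext (u v : H) : (forall w, '[w, u] = '[w, v]) -> u = v.
Proof.
move=> uv; apply/eqP; rewrite -subr_eq0; apply/eqP.
apply: (rh_eq0 hdot_real) => //.
by rewrite /reform hdotC cReJ linearBr/= uv subrr.
Qed.

End HilbertSpace.

(** * Limits of sequences *)

Definition hlim (R : realType) (H : hilbertType R) (x : nat -> H) (u : H) :=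
  forall eps : R, 0 < eps -> exists N, forall n,
      (N <= n)%N -> hnorm (x n - u) < eps.

(** Serves to show that adjoints are closed. After [Re_eq] the scalar [c] is absorbed into [a] and
    [b], and the real Cauchy-Schwarz inequality bounds both errors. *)
Lemma hlim_hdot (R : realType) (H K : hilbertType R)
    (x : nat -> H) (y : nat -> K) u v a b :
  hlim x u -> hlim y v -> (forall n, '[a, x n] = '[b, y n]) ->
  '[a, u] = '[b, v].
Proof.
move=> xu yv xy; apply: Re_eq => c.
suff bnd : forall eps : R, 0 < eps ->
    `|Re (c * '[a, u]) - Re (c * '[b, v])| <= eps.
  apply/eqP; rewrite -subr_eq0 -normr_le0; apply/ler_addgt0Pr => eps e0.
  by rewrite add0r; exact: bnd.
move=> eps e0.
(* The 1 keeps the denominator positive when [c *: z = 0]. *)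
have den0 (X : hilbertType R) (z : X) : 0 < 2 * (hnorm (c *: z) + 1).
  by have := hnorm_ge0 (c *: z); lra.
have [|N1 N1P] := xu (eps / (2 * (hnorm (c *: a) + 1))).
  by rewrite divr_gt0.
have [|N2 N2P] := yv (eps / (2 * (hnorm (c *: b) + 1))).
  by rewrite divr_gt0.
pose n := maxn N1 N2.
have := N1P n (leq_maxl _ _); have := N2P n (leq_maxr _ _).
rewrite !ltr_pdivlMr// => h2 h1.
have cs1 := Re_CauchySchwarz (c *: a) (x n - u).
have cs2 := Re_CauchySchwarz (c *: b) (y n - v).
have -> : Re (c * '[a, u]) - Re (c * '[b, v]) =
    Re '[c *: b, y n - v] - Re '[c *: a, x n - u].
  rewrite !linearBr/= !linearZl_LR/= xy !cReB; ring.
apply: le_trans (ler_normB _ _) _.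
have := hnorm_ge0 (x n - u); have := hnorm_ge0 (y n - v).
nra.
Qed.

(** * Graph inner products *)

Section GraphSpace.
Variables (R : realType) (H K1 K2 : hilbertType R).
Variables (D : set H) (A : H -> K1) (B : H -> K2).
Hypothesis D0 : D 0.
Hypothesis DP : forall (a : R[i]) u v, D u -> D v -> D (a *: u + v).
Hypothesis A_lin : forall (a : R[i]) u v, D u -> D v ->
  A (a *: u + v) = a *: A u + A v.
Hypothesis B_lin : forall (a : R[i]) u v, D u -> D v ->
  B (a *: u + v) = a *: B u + B v.
Hypothesis AB_closed : forall x u v w, (forall n, D (x n)) ->
  hlim x u -> hlim (A \o x) v -> hlim (B \o x) w -> [/\ D u, A u = v & B u = w].

Let e u v := '[A u, A v] + '[u, v] + '[B u, B v].

Let E u := hnorm (A u) ^+ 2 + hnorm u ^+ 2 + hnorm (B u) ^+ 2.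

Let eE u : e u u = (E u)%:C.
Proof. by rewrite /e !hdotE -!rmorphD. Qed.

Let E_ge0 u : 0 <= E u.
Proof. by rewrite !addr_ge0// exprn_ge0// hnorm_ge0. Qed.

Let sqrtE u : sqrtC (e u u) = (Num.sqrt (E u))%:C.
Proof. by rewrite sqrtC_Re eE// ler0c. Qed.

Let DB u v : D u -> D v -> D (u - v).
Proof. by move=> Du Dv; rewrite addrC -scaleN1r; exact: DP. Qed.

Let A_B u v : D u -> D v -> A (u - v) = A u - A v.
Proof. by move=> Du Dv; rewrite addrC -scaleN1r A_lin// scaleN1r addrC. Qed.

Let B_B u v : D u -> D v -> B (u - v) = B u - B v.
Proof. by move=> Du Dv; rewrite addrC -scaleN1r B_lin// scaleN1r addrC. Qed.

(** Being Cauchy for [e] means that [x], [A x] and [B x] are all Cauchy; joint closedness identifies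
    the three limits. It applies both to form domains and to the manifold L. *)
Lemma graph_hilbert_on : hilbert_on D e.
Proof.
split.
- by split.
- by move=> a u u' v Du Du' Dv; rewrite /e A_lin// B_lin// !hdotP; ring.
- move=> u v Du Dv; rewrite /e !rmorphD.
  by congr (_ + _ + _); exact: hdotC.
- move=> u Du u0; rewrite eE ltcR.
  have := rh_gt0 (@hdot_real R H) I u0; rewrite /reform Re_hdot /E.
  have := sqr_ge0 (hnorm (A u)); have := sqr_ge0 (hnorm (B u)).
  by lra.
- move=> x Dx cx.
  have lt_of (X : hilbertType R) (z : X) (t eps : R) :
      hnorm z ^+ 2 <= t -> Num.sqrt t < eps -> hnorm z < eps.
    move=> zt; apply: le_lt_trans.
    by rewrite -(ger0_norm (hnorm_ge0 z)) -sqrtr_sqr ler_wsqrtr.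
  have cE (eps : R) : 0 < eps -> exists N, forall m n,
      (N <= m)%N -> (N <= n)%N -> Num.sqrt (E (x m - x n)) < eps.
    move=> e0; have [|N NP] := cx eps%:C; first by rewrite ltcR.
    by exists N => m n Nm Nn; have := NP m n Nm Nn; rewrite sqrtE ltcR.
  have [u xu] : exists u, hlim x u.
    apply: hnorm_complete => eps /cE[N NP]; exists N => m n Nm Nn.
    apply: lt_of (NP m n Nm Nn); rewrite /E.
    have := sqr_ge0 (hnorm (A (x m - x n))).
    by have := sqr_ge0 (hnorm (B (x m - x n))); lra.
  have [v xv] : exists v, hlim (A \o x) v.
    apply: hnorm_complete => eps /cE[N NP]; exists N => m n Nm Nn.
    apply: lt_of (NP m n Nm Nn); rewrite /E /= -A_B//.
    have := sqr_ge0 (hnorm (x m - x n)).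
    by have := sqr_ge0 (hnorm (B (x m - x n))); lra.
  have [w xw] : exists w, hlim (B \o x) w.
    apply: hnorm_complete => eps /cE[N NP]; exists N => m n Nm Nn.
    apply: lt_of (NP m n Nm Nn); rewrite /E /= -B_B//.
    have := sqr_ge0 (hnorm (x m - x n)).
    by have := sqr_ge0 (hnorm (A (x m - x n))); lra.
  have [Du Au Bu] := AB_closed Dx xu xv xw.
  exists u => // z /gt0_ReE[zE z0]; rewrite -zE; move: (Re z) z0 => eps e0.
  have e2 : 0 < eps / 2 by rewrite divr_gt0.
  have [[N1 N1P] [N2 N2P] [N3 N3P]] :=
    And3 (xu _ e2) (xv _ e2) (xw _ e2).
  exists (maxn N1 (maxn N2 N3)) => n.
  rewrite !geq_max => /and3P[/N1P h1 /N2P /= h2 /N3P /= h3].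
  rewrite sqrtE ltcR -(ger0_norm (ltW e0)) -sqrtr_sqr ltr_sqrt ?exprn_gt0//.
  rewrite /E A_B// B_B// Au Bu.
  have := hnorm_ge0 (x n - u); have := hnorm_ge0 (A (x n) - v).
  have := hnorm_ge0 (B (x n) - w).
  (* Three squares below [eps^2 / 4] add up to less than [eps^2]. *)
  have sq (t : R) : 0 <= t -> t < eps / 2 -> t ^+ 2 < eps ^+ 2 / 3.
    by move=> t0 te; nra.
  by move=> /sq/(_ h3) ? /sq/(_ h2) ? /sq/(_ h1); lra.
Qed.

End GraphSpace.

(** * Linear operators as graphs *)

Section Graphs.
Variables (R : realType) (H K : hilbertType R) (T : set (H * K)).

Lemma opappP u : opdom T u -> T (u, opapp T u).
Proof. by move=> Tu; exact: (xgetPex 0 Tu). Qed.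

Hypothesis T_lin : linear_operator T.

Lemma opapp_eq u w : T (u, w) -> opapp T u = w.
Proof.
case: T_lin => _ _ fT Tu; apply: (fT u) => //; apply: opappP; by exists w.
Qed.

Lemma linear_opP (a : R[i]) u v w z :
  T (u, w) -> T (v, z) -> T (a *: u + v, a *: w + z).
Proof. by case: T_lin => _ h _; exact: (h a (u, w) (v, z)). Qed.

Lemma linear_op0 : T (0, 0). Proof. by case: T_lin. Qed.

Lemma opdomP (a : R[i]) u v : opdom T u -> opdom T v -> opdom T (a *: u + v).
Proof.
by move=> [w Tu] [z Tv]; exists (a *: w + z); exact: linear_opP.
Qed.

Lemma opapp_lin (a : R[i]) u v : opdom T u -> opdom T v ->
  opapp T (a *: u + v) = a *: opapp T u + opapp T v.
Proof.
by move=> Tu Tv; apply: opapp_eq; apply: linear_opP; exact: opappP.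
Qed.

End Graphs.

(** * Algebra of inner products on a manifold *)

Section HilbertOnTheory.
Variables (R : realType) (H : hilbertType R).
Variables (D : set H) (e : H -> H -> R[i]).
Hypothesis he : hilbert_on D e.

Lemma hilbert_onB u v : D u -> D v -> D (u - v).
Proof. exact: (rhB (hilbert_on_real he)). Qed.

Lemma hilbert_onBl u v w : D u -> D v -> D w -> e (u - v) w = e u w - e v w.
Proof.
move=> Du Dv Dw; rewrite addrC -scaleN1r (hilbert_on_lin he)//.
by rewrite mulN1r addrC.
Qed.

Lemma hilbert_on_linr (a : R[i]) u v w : D u -> D v -> D w ->
  e w (a *: u + v) = (a^*)%R * e w u + e w v.
Proof.
move=> Du Dv Dw; rewrite (hilbert_on_conj he)//; last exact: (hilbert_onP he).
rewrite (hilbert_on_lin he)// rmorphD rmorphM /=.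
by rewrite -!(hilbert_on_conj he).
Qed.

Lemma hilbert_onBr u v w : D u -> D v -> D w -> e w (u - v) = e w u - e w v.
Proof.
move=> Du Dv Dw; rewrite addrC -scaleN1r hilbert_on_linr//.
by rewrite rmorphN1 mulN1r addrC.
Qed.

Lemma hilbert_on_eq0 u : D u -> e u u = 0 -> u = 0.
Proof.
move=> Du eu; apply: (rh_eq0 (hilbert_on_real he)) => //.
by rewrite /reform eu.
Qed.

Lemma hilbert_on_ext u u' : D u -> D u' ->
  (forall v, D v -> e v u = e v u') -> u = u'.
Proof.
move=> Du Du' uu'; apply/eqP; rewrite -subr_eq0; apply/eqP.
have Dd : D (u - u') by exact: hilbert_onB.
by apply: hilbert_on_eq0 => //; rewrite hilbert_onBr// uu'// subrr.
Qed.

End HilbertOnTheory.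

(** * The adjoint of a bounded surjection *)

Section BoundedSurjection.
Variables (R : realType) (H K : hilbertType R).
Variables (D : set H) (e : H -> H -> R[i]) (G : set (H * K)).
Hypothesis he : hilbert_on D e.
Hypothesis G_lin : linear_operator G.
Hypothesis G_dom : opdom G = D.
Hypothesis G_cont : continuous_on D e G.

Let g := opapp G.
Let N := rnorm (reform e).

Let D0 : D 0 := hilbert_on0 he.

Let g0 : g 0 = 0.
Proof. by apply: (opapp_eq G_lin); exact: (linear_op0 G_lin). Qed.

Let g_lin (a : R[i]) u v : D u -> D v -> g (a *: u + v) = a *: g u + g v.
Proof. by move=> Du Dv; apply: (opapp_lin G_lin); rewrite G_dom. Qed.

Lemma continuous_on_bound :
  exists2 C : R, 0 <= C & forall v, D v -> hnorm (opapp G v) <= C * N v.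
Proof.
have [d /gt0_ReE[<- d0] dP] := G_cont D0 (@ltr01 R[i]).
move: (Re d) d0 dP => {d} d d0 dP.
exists (2 / d); first by rewrite divr_ge0// ltW.
move=> v Dv; have [->|v0] := eqVneq v 0.
  rewrite -/(g 0) g0 /hnorm (rnorm0 (@hdot_real R K)).
  by rewrite /N (rnorm0 (hilbert_on_real he)) mulr0.
have Nv : 0 < N v by exact: (rnorm_gt0 (hilbert_on_real he)).
(* Rescales [v] to norm [d / 2], inside the ball around 0 on which [g] has norm below 1; hence the
   constant [2 / d]. *)
pose t : R := d / (2 * N v).
have t0 : 0 < t by rewrite divr_gt0// mulr_gt0.
have Dtv : D (t%:C *: v) by exact: (rhZ (hilbert_on_real he)).
have := dP _ Dtv; rewrite !subr0 (hilbert_on_sqrtC he)//.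
rewrite -/(g _) -/(g 0) g0 subr0.
rewrite (rnormZ (hilbert_on_real he))// gtr0_norm// -/N.
have -> : t * N v = d / 2 by rewrite /t; field; rewrite gt_eqF.
have -> : g (t%:C *: v) = t%:C *: g v.
  by have := g_lin t%:C Dv D0; rewrite !addr0 g0 addr0.
rewrite normE ltcR ltr_pdivrMr// ltr_pMr// ltr1n => /(_ isT).
rewrite -(rmorph1 (real_complex R)) ltcR /hnorm (rnormZ (@hdot_real R K))//.
rewrite gtr0_norm// mulrC -ltr_pdivlMr// /t div1r invf_div => /ltW.
by rewrite mulrAC.
Qed.

Hypothesis G_ran : opran G = setT.

Let g_surj k : exists2 v, D v & g v = k.
Proof.
have [v Gv] : opran G k by rewrite G_ran.
by exists v; [rewrite -G_dom; exists k|exact: (opapp_eq G_lin)].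
Qed.

(* On the set of the k with |Gs k| <= 1, the bounds |(g v, k)| <= |v| and the
   surjectivity of g make (., k) pointwise bounded; uniform boundedness then
   gives the lower bound of Gs, which makes (Gs k, Gs k') a complete inner
   product on K, to which the Riesz theorem applies. *)
Theorem surjection_adjoint : exists (Gs : K -> H) (M : R),
  [/\ forall k, D (Gs k),
      forall k v, D v -> e v (Gs k) = '[opapp G v, k],
      0 <= M /\ forall k, hnorm k <= M * rnorm (reform e) (Gs k) &
      forall w, D w -> (forall v, opker G v -> e v w = 0) ->
        exists k, w = Gs k].
Proof.
have her := hilbert_on_real he.
have hk := @hdot_real R K.
have [C C0 CP] := continuous_on_bound.
have adjP k : exists w, D w /\ forall v, D v -> '[g v, k] = e v w.
  have [|v Dv|w Dw wP] := hilbert_on_riesz he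
      (f := fun v => '[g v, k]) (C := C * hnorm k).
  - by move=> a u v Du Dv; rewrite g_lin// hdotP.
  - apply: le_trans (Re_CauchySchwarz _ _) _.
    by rewrite mulrAC ler_wpM2r ?hnorm_ge0// CP.
  - by exists w.
have [Gs GsP] := choice adjP.
have DGs k : D (Gs k) by have [] := GsP k.
have eGs k v : D v -> e v (Gs k) = '[g v, k].
  by move=> Dv; have [_ ->] := GsP k.
have Gs_lin (a : R[i]) k k' : Gs (a *: k + k') = a *: Gs k + Gs k'.
  apply: (hilbert_on_ext he) => // [|v Dv]; first exact: (hilbert_onP he).
  by rewrite (hilbert_on_linr he)// !eGs// linearPr/=.
have Gs0 : Gs 0 = 0.
  apply: (hilbert_on_ext he) => // v Dv.
  rewrite eGs// linear0r (hilbert_on_conj he)//.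
  have := hilbert_onBl he D0 D0 Dv; rewrite subrr subrr => ->.
  by rewrite rmorph0.
(* Writing [k = g v] gives [(k, k) = e v (Gs k)]. *)
have Gs_inj k : Gs k = 0 -> k = 0.
  move=> Gk; have [v Dv vk] := g_surj k.
  have : '[k, k] = 0 by rewrite -{1}vk -eGs// Gk -Gs0 eGs// linear0r.
  by move=> /eqP; rewrite dnorm_eq0 => /eqP.
have [M MP] : exists M, forall k, N (Gs k) <= 1 -> hnorm k <= M.
  apply: (uniform_boundedness hk (A := [set k | N (Gs k) <= 1])) => // k _.
  have [v Dv vk] := g_surj k; exists (N v) => k' /= Gk'.
  rewrite -vk /reform -eGs//.
  apply: le_trans (rh_CauchySchwarz her Dv (DGs _)) _.
  by rewrite ler_piMr// rnorm_ge0.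
(* Homogeneity extends the bound to all [k]; [|M|] ensures a nonnegative constant. *)
have lower k : hnorm k <= `|M| * N (Gs k).
  have [->|k0] := eqVneq k 0.
    by rewrite /hnorm (rnorm0 hk) mulr_ge0// rnorm_ge0.
  have Gk0 : Gs k != 0 by apply: contra_neq k0; exact: Gs_inj.
  have q0 : 0 < N (Gs k) by exact: (rnorm_gt0 her).
  have := MP ((N (Gs k))^-1%:C *: k).
  have -> : Gs ((N (Gs k))^-1%:C *: k) = (N (Gs k))^-1%:C *: Gs k.
    by have := Gs_lin (N (Gs k))^-1%:C k 0; rewrite Gs0 !addr0.
  rewrite /N (rnormZ her)// -/N gtr0_norm ?invr_gt0// mulVf ?gt_eqF//.
  move=> /(_ (lexx _)); rewrite /hnorm (rnormZ hk)// -/(hnorm k).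
  rewrite gtr0_norm ?invr_gt0// ler_pdivrMl// mulrC => /le_trans; apply.
  by rewrite ler_wpM2r ?ler_norm// ltW.
exists Gs, `|M|; split => //.
move=> w Dw wker.
pose e' k k' := e (Gs k) (Gs k').
have upper k : N (Gs k) <= C * hnorm k.
  have [->|k0] := eqVneq k 0.
    by rewrite Gs0 /N (rnorm0 her) mulr_ge0// rnorm_ge0.
  have Gk0 : Gs k != 0 by apply: contra_neq k0; exact: Gs_inj.
  have q0 : 0 < N (Gs k) by exact: (rnorm_gt0 her).
  rewrite -(ler_pM2l q0) -expr2 (sqr_rnorm her)// /reform eGs//.
  apply: le_trans (ler_norm _) _; apply: le_trans (Re_CauchySchwarz _ _) _.
  by rewrite mulrA ler_wpM2r ?hnorm_ge0// mulrC CP.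
have GsB k k' : Gs (k - k') = Gs k - Gs k'.
  by rewrite addrC -scaleN1r Gs_lin scaleN1r addrC.
have he' : hilbert_on setT e'.
  split => //.
  - move=> a u u' v _ _ _; rewrite /e' Gs_lin.
    by rewrite (hilbert_on_lin he).
  - by move=> u v _ _; rewrite /e' (hilbert_on_conj he).
  - move=> u _ u0; case: (he) => _ _ _ pos _; apply: pos => //.
    by apply: contra_neq u0; exact: Gs_inj.
  - move=> x _ cx.
    (* [lower] makes an [e']-Cauchy sequence Cauchy in [K], and [upper] makes its limit in [K] a
       limit for [e']. *)
    have [|k kP] := @hnorm_complete R K x.
      move=> eps e0; pose d := eps / (`|M| + 1).
      have M1 : 0 < `|M| + 1 by have := normr_ge0 M; lra.
      have d0 : 0 < d by rewrite divr_gt0.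
      have [|n nP] := cx d%:C; first by rewrite ltcR.
      exists n => i j ni nj; have := nP i j ni nj.
      rewrite /e' (hilbert_on_sqrtC he)// ltcR ltr_pdivlMr// => h.
      apply: le_lt_trans (lower _) _; apply: le_lt_trans h.
      rewrite mulrC ler_wpM2l ?rnorm_ge0//; lra.
    exists k => // z /gt0_ReE[zE z0]; rewrite -zE; move: (Re z) z0 => eps e0.
    have C1 : 0 < C + 1 by lra.
    have [|n nP] := kP (eps / (C + 1)); first by rewrite divr_gt0.
    exists n => i ni; have := nP i ni.
    rewrite /e' (hilbert_on_sqrtC he)// ltcR ltr_pdivlMr// => h.
    apply: le_lt_trans (upper _) _; apply: le_lt_trans h.
    rewrite mulrC ler_wpM2l ?hnorm_ge0//; lra.
have [|v _|k0 _ k0P] := hilbert_on_riesz he'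
    (f := fun k => e (Gs k) w) (C := N w).
- by move=> a k k' _ _; rewrite Gs_lin (hilbert_on_lin he).
- apply: le_trans (rh_CauchySchwarz her (DGs v) Dw) _.
  by rewrite mulrC.
exists k0; apply/eqP; rewrite -subr_eq0; apply/eqP.
(* The residual [x] is orthogonal to the range of [Gs], hence [g x = 0]. Then [e x w = 0] by
   hypothesis and [e x (Gs k0) = (g x, k0) = 0], so [e x x = 0]. *)
set x := w - Gs k0; have Dx : D x by exact: (hilbert_onB he).
have gx : g x = 0.
  apply: hdot_ext => k; rewrite linear0r hdotC -eGs// (hilbert_on_conj he)//.
  by rewrite conjCK (hilbert_onBr he)// k0P// subrr.
apply: (hilbert_on_eq0 he) => //; rewrite (hilbert_onBr he)//.
rewrite eGs// gx hdot0 wker ?subr0// /opker /= -gx.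
by apply: opappP; rewrite G_dom.
Qed.

End BoundedSurjection.

(** * Adjoints of densely defined operators *)

Section Adjoint.
Variables (R : realType) (H : hilbertType R) (S : set (H * H)).

Lemma adjointP (a : R[i]) u v w z :
  adjoint S (u, w) -> adjoint S (v, z) -> adjoint S (a *: u + v, a *: w + z).
Proof.
by move=> uw vz x y Sxy /=; rewrite !linearPr/= (uw x y)// (vz x y).
Qed.

Lemma adjoint_closed (x y : nat -> H) u v :
  (forall n, adjoint S (x n, y n)) -> hlim x u -> hlim y v -> adjoint S (u, v).
Proof.
by move=> xy xu yv a b Sab; apply: (hlim_hdot xu yv) => n; exact: (xy n a b).
Qed.

Hypothesis S_dense : dense (opdom S).

Lemma adjoint_fun u w w' : adjoint S (u, w) -> adjoint S (u, w') -> w = w'.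
Proof.
move=> uw uw'; apply/eqP; rewrite -subr_eq0; apply/negP => /negP d0.
set d := w - w' in d0.
have dP x : opdom S x -> '[x, d] = 0.
  by move=> [y Sxy]; rewrite linearBr/= -(uw x y)// -(uw' x y)// subrr.
have hd : 0 < hnorm d by exact: (rnorm_gt0 (@hdot_real R H)).
have hdC : 0 < (hnorm d)%:C by rewrite ltcR.
(* Density gives [x] in the domain with [|d - x| < |d|]; as [(x, d) = 0],
   [|d|^2 = Re (d - x, d) <= |d - x| |d|], a contradiction. *)
have [||x [/= bx /dP xd]] := @S_dense (ball d (hnorm d)%:C).
- by exists d; exact: ballxx.
- exact: ball_open.
move: bx; rewrite -ball_normE /= normE ltcR => bx.
have := Re_CauchySchwarz (d - x) d.
rewrite hdotB xd subr0 Re_hdot ger0_norm ?sqr_ge0// expr2 ler_pM2r//.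
by rewrite leNgt bx.
Qed.

Lemma adjoint_linear : linear_operator (adjoint S).
Proof.
split.
- by move=> x y _; rewrite /= !linear0r.
- by move=> a [u w] [v z]; exact: adjointP.
- exact: adjoint_fun.
Qed.

End Adjoint.

(** * Forms of nonnegative selfadjoint operators *)

Section SelfadjointForm.
Variables (R : realType) (H : hilbertType R).

Lemma selfadjoint_sym (T : set (H * H)) u w v z : selfadjoint T ->
  T (u, w) -> T (v, z) -> '[w, v] = '[u, z].
Proof. by case=> _ _ TE Tuw; rewrite -TE => /(_ u w Tuw). Qed.

Lemma extension_adjoint (S T : set (H * H)) u w : selfadjoint T -> S `<=` T ->
  T (u, w) -> adjoint S (u, w).
Proof. by move=> Tsa ST Tuw x y /ST Txy; exact: (selfadjoint_sym Tsa). Qed.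

(** The default value [set0] has empty domain, so a nonempty form domain shows that a square root
    exists. *)
Lemma opsqrtP (T : set (H * H)) : formdom T !=set0 -> is_sqrt T (opsqrt T).
Proof.
rewrite /formdom /opsqrt => -[u [w]].
by case: xgetP => //= Q ->.
Qed.

Variable T : set (H * H).
Hypothesis T_sqrt : is_sqrt T (opsqrt T).

Let Q := opsqrt T.
Let q := opapp Q.

Let Q_sa : selfadjoint Q. Proof. by case: T_sqrt. Qed.

Let Q_lin : linear_operator Q. Proof. by case: Q_sa. Qed.

Let QP u : formdom T u -> Q (u, q u). Proof. exact: opappP. Qed.

Lemma formdomP (a : R[i]) u v :
  formdom T u -> formdom T v -> formdom T (a *: u + v).
Proof. exact: (opdomP Q_lin). Qed.

Lemma formdom0 : formdom T 0.
Proof. by exists 0; exact: (linear_op0 Q_lin). Qed.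

Lemma opsqrt_lin (a : R[i]) u v : formdom T u -> formdom T v ->
  opapp (opsqrt T) (a *: u + v) =
  a *: opapp (opsqrt T) u + opapp (opsqrt T) v.
Proof. exact: (opapp_lin Q_lin). Qed.

(** The square root equals its adjoint, and adjoints are closed. *)
Lemma opsqrt_closed (x : nat -> H) u v : (forall n, formdom T (x n)) ->
  hlim x u -> hlim (opapp (opsqrt T) \o x) v ->
  formdom T u /\ opapp (opsqrt T) u = v.
Proof.
move=> Dx xu xv; have [_ _ QE] := Q_sa.
have Quv : Q (u, v).
  rewrite -QE; apply: (adjoint_closed _ xu xv) => n.
  by rewrite QE; exact: QP.
by split; [exists v|exact: (opapp_eq Q_lin)].
Qed.

Lemma form_hilbert : hilbert_on (formdom T) (form_dot T).
Proof.
(* The zero operator fills the third slot of [graph_hilbert_on]. *)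
pose Z (_ : H) : H := 0.
have -> : form_dot T = fun u v => '[q u, q v] + '[u, v] + '[Z u, Z v].
  by apply/funext => u; apply/funext => v; rewrite hdot0 addr0.
apply: graph_hilbert_on.
- exact: formdom0.
- exact: formdomP.
- exact: opsqrt_lin.
- by move=> a u v _ _; rewrite /Z scaler0 addr0.
- move=> x u v w Dx xu xv xw.
  have [Du qu] := opsqrt_closed Dx xu xv; split => //.
  apply: hdot_ext => c; rewrite linear0r.
  have := @hlim_hdot _ _ _ _ _ _ _ c 0 xw xu; rewrite hdot0 => -> // n.
  by rewrite /= linear0r hdot0.
Qed.

Lemma hnorm_le_form v : hnorm v <= rnorm (reform (form_dot T)) v.
Proof.
rewrite /hnorm /rnorm ler_wsqrtr// /reform /form_dot cReD lerDr.
by rewrite (ge0_ReE (hdot_ge0 _)).2.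
Qed.

Lemma hnorm_opsqrt_le_form v :
  hnorm (opapp (opsqrt T) v) <= rnorm (reform (form_dot T)) v.
Proof.
rewrite /hnorm /rnorm ler_wsqrtr// /reform /form_dot cReD lerDl.
by rewrite (ge0_ReE (hdot_ge0 _)).2.
Qed.

Lemma opform_lin (a : R[i]) u v w : formdom T u -> formdom T v ->
  opform T (a *: u + v) w = a * opform T u w + opform T v w.
Proof. by move=> Du Dv; rewrite /opform opsqrt_lin// hdotP. Qed.

Lemma opformC u v : opform T u v = ((opform T v u)^*)%R.
Proof. exact: hdotC. Qed.

Lemma op_formdom u w : T (u, w) -> formdom T u.
Proof. by case: (T_sqrt) => _ _ {1}<- [z [/= Quz _]]; exists z. Qed.

Lemma op_opform u w v : T (u, w) -> formdom T v -> opform T u v = '[w, v].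
Proof.
case: (T_sqrt) => _ _ {1}<- [z [/= Quz Qzw]] /QP Qv.
by rewrite /opform (opapp_eq Q_lin Quz) (selfadjoint_sym Q_sa Qzw Qv).
Qed.

(** The converse of [op_opform]: the identity [(Q u, Q v) = (w, v)] on the domain of [Q] says that
    [Q u] lies in the domain of the adjoint of [Q], which is [Q], with value [w]. *)
Lemma opform_op u w : formdom T u ->
  (forall v, formdom T v -> opform T u v = '[w, v]) -> T (u, w).
Proof.
move=> Du uw; have Quw : Q (q u, w).
  have [_ _ {1}<-] := Q_sa => v z Qvz /=.
  have Dv : formdom T v by exists z.
  rewrite hdotC [RHS]hdotC -uw//; congr (_^*)%R.
  by rewrite /opform (opapp_eq Q_lin Qvz).
by case: (T_sqrt) => _ _ {1}<-; exists (q u); split; first exact: QP.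
Qed.

(** Riesz in D[T] for [v |-> (v, h)] gives [f = (T + I)^-1 h]. *)
Lemma resolvent h : exists2 f, T (f, h - f) &
  forall v, formdom T v -> form_dot T f v = '[h, v].
Proof.
have he := form_hilbert.
have [|v Dv|f Df fP] := hilbert_on_riesz he
    (f := fun v => '[v, h]) (C := hnorm h).
- by move=> a u v _ _; exact: hdotP.
- apply: le_trans (Re_CauchySchwarz _ _) _.
  by rewrite mulrC ler_wpM2l ?hnorm_ge0// hnorm_le_form.
have fh v : formdom T v -> form_dot T f v = '[h, v].
  by move=> Dv; rewrite (hilbert_on_conj he)// -fP// -hdotC.
exists f => //; apply: opform_op => // v Dv.
by rewrite hdotB -fh// addrK.
Qed.

End SelfadjointForm.

(** * The boundary operator of a boundary pair *)

Section BoundaryPair.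
Variables (R : realType) (H K : hilbertType R).
Variables (S S0 S1 : set (H * H)) (G0 : set (H * K)).
Hypotheses (S_dense : dense (opdom S)).
Hypotheses (S0_sa : selfadjoint S0) (S0_ext : S `<=` S0).
Hypotheses (S1_sa : selfadjoint S1) (S1_ext : S `<=` S1).
Hypothesis S01 : closed_form_restriction S0 S1.
Hypothesis bp : boundary_pair S0 S1 G0.

Let G0_lin : linear_operator G0. Proof. by case: bp => -[]. Qed.
Let G0_dom : opdom G0 = formdom S1. Proof. by case: bp => -[]. Qed.
Let G0_ker : opker G0 = formdom S0. Proof. by case: bp. Qed.
Let G0_ran : opran G0 = setT. Proof. by case: bp. Qed.

(* A linear Gamma0 has 0 in its domain and kernel, so neither form domain is
   empty, and the two square roots exist. *)
Let S1_sqrt : is_sqrt S1 (opsqrt S1).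
Proof.
by apply: opsqrtP; rewrite -G0_dom; exists 0, 0; exact: (linear_op0 G0_lin).
Qed.

Let S0_sqrt : is_sqrt S0 (opsqrt S0).
Proof.
by apply: opsqrtP; rewrite -G0_ker; exists 0; exact: (linear_op0 G0_lin).
Qed.

Let he := form_hilbert S1_sqrt.
Let N := rnorm (reform (form_dot S1)).
Let St := opapp (adjoint S).
Let St_lin := adjoint_linear S_dense.
Let g := opapp G0.

Let sub01 v : formdom S0 v -> formdom S1 v.
Proof. by case: S01 => h _; exact: h. Qed.

Let form01 u v : formdom S0 u -> formdom S0 v ->
  opform S0 u v = opform S1 u v.
Proof. by case: S01 => _; apply. Qed.

Let dom01 u w : S (u, w) -> formdom S0 u.
Proof. by move=> /S0_ext; exact: (op_formdom S0_sqrt). Qed.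

(** For [a] in dom S, contained in D[S0], orthogonality reads [S1[a,n] + (a,n) = 0], and [S1[a,n] =
    (S a, n)]. Thus the complement lies in the kernel of S* + I. *)
Lemma form_ortho_adjoint n : form_ortho S0 S1 n -> adjoint S (n, - n).
Proof.
move=> [Dn nP] a b Sab /=.
have := nP _ (dom01 Sab); rewrite /form_dot opformC.
rewrite (op_opform S1_sqrt (S1_ext Sab) Dn) (hdotC n a) -rmorphD.
by move=> /eqP; rewrite conjC_eq0 addr_eq0 linearNr => /eqP.
Qed.

Lemma form_ortho_sub n : form_ortho S0 S1 n -> manifoldL S0 S1 n.
Proof.
move=> nP; exists 0, n; split => //; last by rewrite add0r.
by exists 0; case: S0_sa => -[].
Qed.

Lemma manifoldLP u : manifoldL S0 S1 u <-> formdom S1 u /\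
  exists2 w, adjoint S (u, w) &
    forall v, formdom S0 v -> opform S1 u v = '[w, v].
Proof.
split=> [[f [n [[h S0fh] nP ->]]]|[Du [w uw uP]]].
  have Df := op_formdom S0_sqrt S0fh; have [Dn nO] := nP.
  split.
    by rewrite -[f]scale1r; apply: (formdomP S1_sqrt) => //; exact: sub01.
  (* S* takes [f] to [S0 f = h] and [n] to [- n]. *)
  exists (h - n).
    rewrite -[f]scale1r -[h]scale1r.
    apply: adjointP; last exact: form_ortho_adjoint.
    exact: (extension_adjoint S0_sa S0_ext).
  move=> v Dv; rewrite -[f]scale1r (opform_lin S1_sqrt)//; last exact: sub01.
  rewrite mul1r -form01// (op_opform S0_sqrt S0fh)// hdotB; congr (_ + _).
  by apply/eqP; rewrite -addr_eq0; apply/eqP; exact: nO.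
(* The component in dom S0 is [(S0 + I)^-1 (S* u + u)]: its form product with any [v] in D[S0] is
   [(w + u, v)], as is that of [u], so [u - f] is orthogonal to D[S0]. *)
have [f S0f fP] := resolvent S0_sqrt (w + u).
have Df := op_formdom S0_sqrt S0f.
exists f, (u - f); split; last by rewrite addrC subrK.
  by exists (w + u - f).
split; first by apply: (hilbert_onB he) => //; exact: sub01.
move=> v Dv; rewrite (hilbert_onBl he)//; [|exact: sub01|exact: sub01].
rewrite {1}/form_dot uP// -hdotD -fP// /form_dot form01// subrr//.
Qed.

Lemma manifoldL_formdom u : manifoldL S0 S1 u -> formdom S1 u.
Proof. by move=> /manifoldLP[]. Qed.

Lemma manifoldL_adjoint u :
  manifoldL S0 S1 u -> adjoint S (u, opapp (adjoint S) u).
Proof. by move=> /manifoldLP[_ [w uw _]]; apply: opappP; exists w. Qed.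

Lemma manifoldL_form u v : manifoldL S0 S1 u -> formdom S0 v ->
  opform S1 u v = '[opapp (adjoint S) u, v].
Proof.
by move=> /manifoldLP[_ [w uw uP]] Dv; rewrite uP// (opapp_eq St_lin uw).
Qed.

Lemma eta_hilbert : hilbert_on (manifoldL S0 S1) (eta_dot S S1).
Proof.
have dS u : manifoldL S0 S1 u -> opdom (adjoint S) u.
  by move=> /manifoldL_adjoint; exists (St u).
apply: (graph_hilbert_on (A := opapp (opsqrt S1)) (B := St)).
- apply/manifoldLP; split; first exact: (formdom0 S1_sqrt).
  exists 0; first by have [] := St_lin.
  move=> v Dv; rewrite hdot0.
  have D0 := formdom0 S1_sqrt.
  have := opform_lin S1_sqrt 1 v D0 D0; rewrite scaler0 addr0 mul1r => /eqP.
  by rewrite -subr_eq subrr eq_sym => /eqP.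
- move=> a u v Lu Lv; apply/manifoldLP; split.
    by apply: (formdomP S1_sqrt); exact: manifoldL_formdom.
  exists (a *: St u + St v); first by apply: adjointP; exact: manifoldL_adjoint.
  move=> z Dz; rewrite (opform_lin S1_sqrt); [|exact: manifoldL_formdom..].
  by rewrite !manifoldL_form// hdotP.
- by move=> a u v Lu Lv; apply: (opsqrt_lin S1_sqrt); exact: manifoldL_formdom.
- by move=> a u v Lu Lv; apply: (opapp_lin St_lin); exact: dS.
- move=> x u v w Lx xu xv xw.
  have Dx n : formdom S1 (x n) := manifoldL_formdom (Lx n).
  have [Du qu] := opsqrt_closed S1_sqrt Dx xu xv.
  have uw : adjoint S (u, w).
    by apply: (adjoint_closed _ xu xw) => n; exact: manifoldL_adjoint.
  split => //; last exact: (opapp_eq St_lin).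
  apply/manifoldLP; split => //; exists w => // z Dz.
  (* Conjugation moves the converging sequences to the second slot, as [hlim_hdot] requires. *)
  rewrite /opform qu hdotC [RHS]hdotC; congr (_^*)%R.
  apply: (hlim_hdot xv xw) => n /=.
  rewrite hdotC [RHS]hdotC; congr (_^*)%R.
  exact: (manifoldL_form (Lx n) Dz).
Qed.

(** The required identity itself serves as the graph, so linearity is immediate and existence
    becomes the claim that the domain is all of L. *)
Definition boundary_map : set (H * K) :=
  [set p | manifoldL S0 S1 p.1 /\ forall v, formdom S1 v ->
    opform S1 p.1 v = '[opapp (adjoint S) p.1, v] - '[p.2, opapp G0 v]].

Let g_surj k : exists2 v, formdom S1 v & g v = k.
Proof.
have [v Gv] : opran G0 k by rewrite G0_ran.
by exists v; [rewrite -G0_dom; exists k|exact: (opapp_eq G0_lin)].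
Qed.

Lemma boundary_map_linear : linear_operator boundary_map.
Proof.
have hl := eta_hilbert.
split.
- split => [|v Dv] /=; first exact: (hilbert_on0 hl).
  rewrite (opapp_eq St_lin (linear_op0 St_lin)) !hdot0 subr0.
  have D0 := formdom0 S1_sqrt.
  have := opform_lin S1_sqrt 1 v D0 D0; rewrite scaler0 addr0 mul1r => /eqP.
  by rewrite -subr_eq subrr eq_sym => /eqP.
- move=> a [u k] [u' k'] /= [Lu uP] [Lu' uP'].
  split => [|v Dv] /=; first exact: (hilbert_onP hl).
  rewrite (opform_lin S1_sqrt); [|exact: manifoldL_formdom..].
  rewrite uP// uP'// (opapp_lin St_lin).
  + by rewrite !hdotP; ring.
  + by exists (St u); exact: manifoldL_adjoint.
  + by exists (St u'); exact: manifoldL_adjoint.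
(* Surjectivity of Gamma0 makes every [z] a value against which [k] and [k'] can be compared. *)
- move=> u k k' [_ uP] [_ uP']; apply: hdot_ext => z.
  have [v Dv <-] := g_surj z; rewrite hdotC [RHS]hdotC; congr (_^*)%R.
  have := uP v Dv; rewrite /= (uP' v Dv) /= => /addrI/oppr_inj.
  by move=> ->.
Qed.

(** The identity places [G] inside [boundary_map]; since [G] has domain L and [boundary_map] is
    single-valued, they coincide. *)
Lemma boundary_map_unique (G : set (H * K)) : linear_operator G ->
  opdom G = manifoldL S0 S1 ->
  (forall u v, manifoldL S0 S1 u -> formdom S1 v -> opform S1 u v =
     '[opapp (adjoint S) u, v] - '[opapp G u, opapp G0 v]) ->
  boundary_map = G.
Proof.
move=> G_lin G_dom GP.
have GB u k : G (u, k) -> boundary_map (u, k).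
  move=> Guk; have Lu : manifoldL S0 S1 u by rewrite -G_dom; exists k.
  by split => // v Dv /=; rewrite GP// (opapp_eq G_lin Guk).
apply/seteqP; split => -[u k]; last exact: GB.
move=> Buk; have [Lu _] := Buk.
have [k' Guk'] : opdom G u by rewrite G_dom.
by case: boundary_map_linear => _ _ /(_ u k k' Buk (GB _ _ Guk')) ->.
Qed.

Lemma boundary_map_bound :
  opdom boundary_map = manifoldL S0 S1 /\
  bounded_on (manifoldL S0 S1) (eta_dot S S1) boundary_map.
Proof.
have G0_cont : continuous_on (formdom S1) (form_dot S1) G0 by case: bp.
have [Gs [M [DGs eGs [M0 lower] GsP]]] :=
  surjection_adjoint he G0_lin G0_dom G0_cont G0_ran.
have her := hilbert_on_real he.
have bnd u v : formdom S1 v ->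
    `|Re ('[v, St u] - opform S1 v u)| <=
    (hnorm (St u) + hnorm (opapp (opsqrt S1) u)) * N v.
  move=> Dv; rewrite cReB; apply: le_trans (ler_normB _ _) _.
  rewrite mulrDl lerD//.
    apply: le_trans (Re_CauchySchwarz _ _) _.
    by rewrite mulrC ler_wpM2l ?hnorm_ge0// (hnorm_le_form S1).
  apply: le_trans (Re_CauchySchwarz _ _) _.
  by rewrite mulrC ler_wpM2l ?hnorm_ge0// (hnorm_opsqrt_le_form S1).
have dom : opdom boundary_map = manifoldL S0 S1.
  apply/seteqP; split => [u [k []]//|u Lu].
  have Du := manifoldL_formdom Lu.
  (* The conjugate of [(S* u, v) - S1[u,v]], because Riesz needs linearity in [v]. *)
  pose f v := '[v, St u] - opform S1 v u.
  have [|w Dw fw] := hilbert_on_riesz he (f := f) _ (bnd u).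
    by move=> a v v' Dv Dv'; rewrite /f hdotP (opform_lin S1_sqrt)//; ring.
  have [|k wk] := GsP w Dw.
    move=> v; rewrite G0_ker => Dv; rewrite -fw; last exact: sub01.
    rewrite /f opformC manifoldL_form//.
    by rewrite -hdotC subrr.
  exists k; split => // v Dv /=.
  have := fw v Dv; rewrite wk eGs// /f => /(congr1 Num.conj).
  rewrite rmorphB /= -opformC -!hdotC => <-.
  by rewrite opprB addrC subrK.
(* With [E] the eta-norm of [u]: [|k| <= M |Gs k|], and [|Gs k| <= |S* u| + |S1^(1/2) u| <= 2 E]. *)
split => //; exists (2 * M)%:C; first by rewrite ler0c mulr_ge0.
move=> u Lu; rewrite (hilbert_on_sqrtC eta_hilbert)// normE -rmorphM lecR.
have Buk : boundary_map (u, opapp boundary_map u).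
  by apply: opappP; rewrite dom.
move: (opapp boundary_map u) Buk => k [_ /= kP].
apply: le_trans (lower k) _; rewrite [2 * M]mulrC -mulrA ler_wpM2l//.
set E := rnorm _ u; set q := hnorm (opapp (opsqrt S1) u).
have EE : eta_dot S S1 u u =
    (q ^+ 2 + hnorm u ^+ 2 + hnorm (St u) ^+ 2)%:C.
  by rewrite /eta_dot /opform !hdotE -!rmorphD.
have le_E (t : R) : 0 <= t ->
    t ^+ 2 <= q ^+ 2 + hnorm u ^+ 2 + hnorm (St u) ^+ 2 -> t <= E.
  move=> t0 h; rewrite /E /rnorm /reform EE /= -(ger0_norm t0) -sqrtr_sqr.
  by rewrite ler_wsqrtr.
have h1 : q <= E.
  apply: le_E; first exact: hnorm_ge0.
  by rewrite -addrA lerDl addr_ge0// sqr_ge0.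
have h2 : hnorm (St u) <= E.
  apply: le_E; first exact: hnorm_ge0.
  by rewrite lerDr addr_ge0// sqr_ge0.
have N0 : 0 <= N (Gs k) by exact: rnorm_ge0.
(* The left side is [(Gamma0 (Gs k), k)], whose real part is that of the functional bounded in
   [bnd], taken at [Gs k]. *)
suff : N (Gs k) * N (Gs k) <= (hnorm (St u) + q) * N (Gs k).
  move: N0; rewrite -/N le_eqVlt => /predU1P[<- _|N0].
    by have := hnorm_ge0 (St u); lra.
  by rewrite ler_pM2r//; lra.
rewrite -expr2 (sqr_rnorm her)//.
apply: le_trans (bnd u (Gs k) (DGs k)).
apply: le_trans (ler_norm _).
rewrite /reform eGs// hdotC cReJ.
have -> : '[k, opapp G0 (Gs k)] = '[St u, Gs k] - opform S1 u (Gs k).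
  by rewrite kP//; ring.
by rewrite !cReB hdotC cReJ opformC cReJ.
Qed.

(** With boundary value 0 the identity reads [S1[u,v] = (S* u, v)] on all of D[S1], which by
    [opform_op] and [op_opform] characterizes dom S1. *)
Lemma boundary_map_ker : opker boundary_map = opdom S1.
Proof.
apply/seteqP; split => u.
  move=> [Lu uP]; exists (St u); apply: (opform_op S1_sqrt).
    exact: manifoldL_formdom.
  by move=> v Dv; rewrite (uP v Dv) /= hdot0 subr0.
move=> [w S1uw]; have uw := extension_adjoint S1_sa S1_ext S1uw.
split => [|v Dv] /=.
  apply/manifoldLP; split; first exact: (op_formdom S1_sqrt S1uw).
  by exists w => // v Dv; apply: (op_opform S1_sqrt) => //; exact: sub01.
by rewrite hdot0 subr0 (opapp_eq St_lin uw) (op_opform S1_sqrt S1uw).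
Qed.

Lemma boundary_map_ran : opran boundary_map = setT.
Proof.
have G0_cont : continuous_on (formdom S1) (form_dot S1) G0 by case: bp.
have [Gs [M [DGs eGs _ _]]] :=
  surjection_adjoint he G0_lin G0_dom G0_cont G0_ran.
apply/seteqP; split => // k _.
have D0 := formdom0 S1_sqrt.
have DN : formdom S1 (- Gs k) by rewrite -sub0r; exact: (hilbert_onB he).
have eN v : formdom S1 v -> form_dot S1 (- Gs k) v = - '[k, g v].
  move=> Dv; rewrite -sub0r (hilbert_onBl he)//.
  have := hilbert_onBl he D0 D0 Dv; rewrite subrr subrr => ->.
  by rewrite sub0r (hilbert_on_conj he)// eGs// -hdotC.
(* D[S0] is the kernel of Gamma0, where [eN] gives 0. *)
have oN : form_ortho S0 S1 (- Gs k).
  split => // v Dv; rewrite eN; last exact: sub01.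
  have Gv : G0 (v, 0) by move: Dv; rewrite -G0_ker.
  by rewrite /g (opapp_eq G0_lin Gv) linear0r oppr0.
exists (- Gs k); split; first exact: form_ortho_sub.
(* For [n = - Gs k], [S* n = - n], so the identity to prove is [S1[n,v] + (n,v) = - (k, Gamma0 v)],
   which is [eN]. *)
move=> v Dv /=; rewrite (opapp_eq St_lin (form_ortho_adjoint oN)).
have := eN v Dv; rewrite /form_dot => <-; rewrite opprK.
by rewrite [in RHS]linearNl/=; ring.
Qed.

End BoundaryPair.

Theorem theorem7p11 (R : realType) (H : hilbertType R) (HS : separable_space H)
    (S S0 S1 : set (H * H))
    (S_linear : linear_operator S) (S_dense : dense (opdom S))
    (S_symmetric : symmetric_op S) (S_nonnegative : nonnegative_op S)
    (S0_selfadjoint : selfadjoint S0) (S0_nonnegative : nonnegative_op S0)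
    (S0_extends : S `<=` S0)
    (S1_selfadjoint : selfadjoint S1) (S1_nonnegative : nonnegative_op S1)
    (S1_extends : S `<=` S1)
    (dom_capE : opdom S1 `&` opdom S0 = opdom S)
    (S0_S1_forms : closed_form_restriction S0 S1)
    (K : hilbertType R) (Gamma0 : set (H * K))
    (bpair : boundary_pair S0 S1 Gamma0) :
  exists Gamma1 : set (H * K),
    unique (fun G : set (H * K) =>
      [/\ linear_operator G, opdom G = manifoldL S0 S1 &
          forall u v : H, manifoldL S0 S1 u -> formdom S1 v ->
            opform S1 u v =
              '[opapp (adjoint S) u, v] - '[opapp G u, opapp Gamma0 v]])
      Gamma1 /\
    [/\ hilbert_on (manifoldL S0 S1) (eta_dot S S1),
        bounded_on (manifoldL S0 S1) (eta_dot S S1) Gamma1,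
        opker Gamma1 = opdom S1 &
        opran Gamma1 = setT].
Proof.
have B_lin := boundary_map_linear S_dense S0_selfadjoint S0_extends
  S1_extends S0_S1_forms bpair.
have [B_dom B_bnd] := boundary_map_bound S_dense S0_selfadjoint S0_extends
  S1_extends S0_S1_forms bpair.
exists (boundary_map S S0 S1 Gamma0); split.
  split=> [|G [G_lin G_dom GP]]; last first.
    exact: (boundary_map_unique S_dense S0_selfadjoint S0_extends S1_extends
      S0_S1_forms bpair).
  split=> // u v Lu Dv.
  have Bu : opdom (boundary_map S S0 S1 Gamma0) u by rewrite B_dom.
  have [_ uP] := opappP Bu.
  exact: uP.
split => //.
- exact: (eta_hilbert S_dense S0_selfadjoint S0_extends S1_extends
    S0_S1_forms bpair).
- exact: (boundary_map_ker S_dense S0_selfadjoint S0_extends S1_selfadjoint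
    S1_extends S0_S1_forms bpair).
- exact: (boundary_map_ran S_dense S0_selfadjoint S0_extends S1_extends
    S0_S1_forms bpair).
Qed.
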